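(* Let $\mathbb{K}$ be a field. There is a covariant functor $\mathcal{F}:\widetilde{\mathcal{S}pec}\longrightarrow DGA$, from the category of even algebraic spectral triples over $\mathbb{K}$ to the category of nonnegatively graded differential graded algebras over $\mathbb{K}$, given on objects by $(\mathcal{A},\mathbb{V},D,\gamma)\longmapsto\Omega_D^\bullet(\mathcal{A})$.
   Context: An even algebraic spectral triple $(\mathcal{A},\mathbb{V},D,\gamma)$ over $\mathbb{K}$ consists of a unital associative $\mathbb{K}$-algebra $\mathcal{A}$, a $\mathbb{K}$-vector space $\mathbb{V}$ with a unital representation $\pi:\mathcal{A}\to\mathcal{E}nd(\mathbb{V})$, a linear operator $D\in\mathcal{E}nd(\mathbb{V})$, and a $\mathbb{Z}_2$-grading operator $\gamma\in\mathcal{E}nd(\mathbb{V})$ (so $\gamma^2=1$) which commutes with every $\pi(a)$ and anticommutes with $D$. Objects of $\widetilde{\mathcal{S}pec}$ are the even algebraic spectral triples. A morphism $(\mathcal{A}_1,\mathbb{V}_1,D_1,\gamma_1)\to(\mathcal{A}_2,\mathbb{V}_2,D_2,\gamma_2)$ is a pair $(\phi,\Phi)$ with $\phi:\mathcal{A}_1\to\mathcal{A}_2$ a unital algebra morphism and $\Phi:\mathbb{V}_1\to\mathbb{V}_2$ a surjective linear map such that $\Phi D_1=D_2\Phi$, $\Phi\gamma_1=\gamma_2\Phi$ and $\Phi\pi_1(x)=\pi_2(\phi(x))\Phi$ for all $x\in\mathcal{A}_1$. Reduced universal dga: $\Omega^\bullet(\mathcal{A})=\bigoplus_{k\ge0}\Omega^k(\mathcal{A})$,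 $\Omega^k(\mathcal{A})=\mathcal{A}\otimes\bar{\mathcal{A}}^{\otimes k}$ with $\bar{\mathcal{A}}=\mathcal{A}/\mathbb{K}$; write $a_0\,da_1\cdots da_k$ for $a_0\otimes\bar a_1\otimes\cdots\otimes\bar a_k$; $d(a_0da_1\cdots da_k)=da_0da_1\cdots da_k$, and the product is determined by the graded Leibniz rule. It is represented on $\mathbb{V}$ by $\pi(a_0da_1\cdots da_k)=a_0[D,a_1]\cdots[D,a_k]$ (elements of $\mathcal{A}$ acting via $\pi$). Put $J_0^{k}=\{\omega\in\Omega^k(\mathcal{A}):\pi(\omega)=0\}$, $J^{k}=J_0^{k}+dJ_0^{k-1}$, $J^\bullet=\bigoplus_kJ^k$ (a differential graded two-sided ideal), and $\Omega_D^\bullet(\mathcal{A})=\Omega^\bullet(\mathcal{A})/J^\bullet$, a dga with the induced differential; $\pi$ induces $\Omega_D^k(\mathcal{A})\cong\pi(\Omega^k(\mathcal{A}))/\pi(dJ_0^{k-1})$ for $k\ge1$. On morphisms, $\mathcal{F}(\phi,\Phi):\Omega_{D_1}^\bullet(\mathcal{A}_1)\to\Omega_{D_2}^\bullet(\mathcal{A}_2)$ sends $\left[\sum a_0\prod_{i=1}^n[D_1,a_i]\right]$ to $\left[\sum\phi(a_0)\prod_{i=1}^n[D_2,\phi(a_i)]\right]$. *)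

(* Defs.v *)
From HB Require Import structures.
From mathcomp Require Import all_boot all_algebra.
From mathcomp Require Import boolp classical_sets functions.
From mathcomp Require Import freeg.

Set Implicit Arguments.
Unset Strict Implicit.
Unset Printing Implicit Defensive.

Import GRing.Theory.
Local Open Scope ring_scope.
Local Open Scope quotient_scope.

Section LinearFunctions.
Variables (K : fieldType) (U V : lmodType K) (f : U -> V).
Hypothesis linf : linear f.

Let g : {linear U -> V} := HB.pack f (GRing.isLinear.Build K U V *:%R f linf).

Lemma lin0 : f 0 = 0. Proof. exact: (linear0 g). Qed.
Lemma linD x y : f (x + y) = f x + f y. Proof. exact: (linearD g). Qed.
Lemma linB x y : f (x - y) = f x - f y. Proof. exact: (linearB g). Qed.
Lemma linN x : f (- x) = - f x. Proof. exact: (linearN g). Qed.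
Lemma linZ c x : f (c *: x) = c *: f x. Proof. exact: (linearZZ g). Qed.
Lemma lin_sum I (r : seq I) (P : pred I) F :
  f (\sum_(i <- r | P i) F i) = \sum_(i <- r | P i) f (F i).
Proof. exact: (linear_sum g). Qed.
End LinearFunctions.

Lemma lin_comb (K : fieldType) (U V : lmodType K) (c : K) (f g : U -> V) :
  linear f -> linear g -> linear (fun x => c *: f x + g x).
Proof.
by move=> lf lg t x y; rewrite lf lg !scalerDr !scalerA [t * c]mulrC addrACA.
Qed.

Record submodule (K : fieldType) (U : lmodType K) := Submodule {
  submod_mem :> U -> Prop;
  submod0 : submod_mem 0;
  submodP : forall c x y, submod_mem x -> submod_mem y -> submod_mem (c *: x + y)
}.

Section SubmoduleTheory.
Variables (K : fieldType) (U : lmodType K) (S : submodule U).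

Lemma submodD x y : S x -> S y -> S (x + y).
Proof. by move=> Sx Sy; rewrite -[x]scale1r; exact: submodP. Qed.

Lemma submodZ c x : S x -> S (c *: x).
Proof. by move=> Sx; rewrite -[_ *: _]addr0; apply: submodP => //; exact: submod0. Qed.

Lemma submodN x : S x -> S (- x).
Proof. by rewrite -scaleN1r; exact: submodZ. Qed.

Lemma submodB x y : S x -> S y -> S (x - y).
Proof. by move=> Sx Sy; apply: submodD => //; exact: submodN. Qed.

Definition submod_pred : {pred U} := fun x => `[< S x >].

Lemma submod_pred_zmod : zmod_closed submod_pred.
Proof.
split; first by apply/asboolP; exact: submod0.
by move=> x y /asboolP Sx /asboolP Sy; apply/asboolP; exact: submodB.
Qed.
HB.instance Definition _ := GRing.isZmodClosed.Build U submod_pred submod_pred_zmod.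

Definition quotm := Quotient.quot submod_pred.
HB.instance Definition _ := GRing.Zmodule.on quotm.
HB.instance Definition _ := Quotient.on quotm.

Definition qclass (x : U) : quotm := \pi_quotm x.

Definition qrep (q : quotm) : U := repr q.

Lemma qrepK q : qclass (qrep q) = q. Proof. exact: reprK. Qed.

Lemma qclassP x y : qclass x = qclass y <-> S (x - y).
Proof.
split=> [/eqP | Sxy]; rewrite /qclass.
  by rewrite -Quotient.idealrBE => /asboolP.
by apply/eqP; rewrite -Quotient.idealrBE; apply/asboolP.
Qed.

Lemma qclassD x y : qclass (x + y) = qclass x + qclass y.
Proof. exact: (@Quotient.pi_add U submod_pred). Qed.

Definition qscale (c : K) (q : quotm) := qclass (c *: qrep q).

Lemma qscaleE c x : qscale c (qclass x) = qclass (c *: x).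
Proof. by apply/qclassP; rewrite -scalerBr; apply/submodZ/qclassP; exact: qrepK. Qed.

Lemma qscaleA a b q : qscale a (qscale b q) = qscale (a * b) q.
Proof. by rewrite -[q]qrepK !qscaleE scalerA. Qed.
Lemma qscale1 : left_id 1 qscale.
Proof. by move=> q; rewrite -[q]qrepK qscaleE scale1r. Qed.
Lemma qscaleDr : right_distributive qscale +%R.
Proof.
by move=> c p q; rewrite -[p]qrepK -[q]qrepK -qclassD !qscaleE -qclassD scalerDr.
Qed.
Lemma qscaleDl q : {morph qscale^~ q : a b / a + b}.
Proof. by move=> a b; rewrite -[q]qrepK !qscaleE -qclassD scalerDl. Qed.

HB.instance Definition _ :=
  GRing.Zmodule_isLmodule.Build K quotm qscaleA qscale1 qscaleDr qscaleDl.

Lemma qclass_lin : linear qclass.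
Proof. by move=> c x y; rewrite qclassD -qscaleE. Qed.

Lemma qclass0 x : qclass x = 0 <-> S x.
Proof. by have := qclassP x 0; rewrite subr0 (lin0 qclass_lin). Qed.

(* The map out of the quotient induced by f, meaningful when f kills S. *)
Definition qlift (W : Type) (f : U -> W) (q : quotm) : W := f (qrep q).

Lemma qliftE (W : lmodType K) (f : U -> W) x :
  linear f -> (forall s, S s -> f s = 0) -> qlift f (qclass x) = f x.
Proof.
move=> linf fS; apply/eqP; rewrite -subr_eq0 -(linB linf); apply/eqP/fS.
by apply/qclassP; exact: qrepK.
Qed.

Lemma qlift_lin (W : lmodType K) (f : U -> W) :
  linear f -> (forall s, S s -> f s = 0) -> linear (qlift f).
Proof.
move=> linf fS c p q; rewrite -[p]qrepK -[q]qrepK -qclass_lin.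
by rewrite !(qliftE _ linf fS) linf.
Qed.
End SubmoduleTheory.
Arguments qclass {K U} S x.

Section Span.
Variables (K : fieldType) (U : lmodType K) (P : U -> Prop).

Definition span_mem (x : U) := forall S : submodule U, (forall y, P y -> S y) -> S x.

Lemma span0 : span_mem 0. Proof. by move=> S _; exact: submod0. Qed.
Lemma spanP c x y : span_mem x -> span_mem y -> span_mem (c *: x + y).
Proof. by move=> Sx Sy S PS; apply: submodP; [exact: Sx | exact: Sy]. Qed.

Definition span_submod := Submodule span0 spanP.
End Span.

Local Notation bilinear_map f := (bilinear_for *:%R *:%R f).

Section Tensor.
Variables (K : fieldType) (U V : lmodType K).

Local Notation free := {freeg (U * V)%type / K}.
Local Notation gen u v := (<< (u, v) >> : free).

Inductive bilinear_relation : free -> Prop :=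
| BilinL c u u' v :
    bilinear_relation (gen (c *: u + u') v - (c *: gen u v + gen u' v))
| BilinR c u v v' :
    bilinear_relation (gen u (c *: v + v') - (c *: gen u v + gen u v')).

Definition tensor : lmodType K := quotm (span_submod bilinear_relation).

Definition tpure (u : U) (v : V) : tensor := qclass _ (gen u v).

(* The map out of U (x) V induced by f, meaningful when f is bilinear. *)
Definition tlift (W : lmodType K) (f : U -> V -> W) : tensor -> W :=
  qlift (fglift (fun p => f p.1 p.2)).

Lemma tpure_bilin : bilinear_map tpure.
Proof.
split=> [v c u u' | u c v v']; rewrite /tpure -qclass_lin; apply/qclassP.
  by move=> S; apply; exact: BilinL.
by move=> S; apply; exact: BilinR.
Qed.

Lemma fglift_lin (T : choiceType) (W : lmodType K) (f : T -> W) :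
  linear (fglift f : {freeg T / K} -> W).
Proof.
have addf (x y : {freeg T / K}) : fglift f (x + y) = fglift f x + fglift f y.
  pose g : {additive {freeg T / K} -> W} := HB.pack (fglift f)
    (GRing.isZmodMorphism.Build _ _ _ (lift_is_additive f)).
  exact: (raddfD g).
have f0 : fglift f (0 : {freeg T / K}) = 0.
  by apply: (addrI (fglift f 0)); rewrite -addf !addr0.
move=> c x y; rewrite addf; congr (_ + _).
rewrite -[x in LHS]freeg_sumE -[x in RHS]freeg_sumE.
elim: (dom x) => [|z s IHs]; first by rewrite !big_nil scaler0 f0 scaler0.
rewrite !big_cons scalerDr !addf scalerDr IHs; congr (_ + _).
suff -> : c *: << coeff z x *g z >> = << c * coeff z x *g z >> :> {freeg T / K}.
  by rewrite !liftU scalerA.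
by apply/eqP/freeg_eqP => t; rewrite coeffZ !coeffU mulrA.
Qed.

Section Lift.
Variables (W : lmodType K) (f : U -> V -> W).
Hypothesis bilf : bilinear_map f.

Let kills s : span_submod bilinear_relation s ->
  fglift (fun p : U * V => f p.1 p.2) s = 0.
Proof.
set g := fglift _; have ling : linear g := @fglift_lin _ _ _.
have g0 : g 0 = 0 := lin0 ling.
have gP c x y : g x = 0 -> g y = 0 -> g (c *: x + y) = 0.
  by move=> gx gy; rewrite ling gx gy scaler0 addr0.
move=> /(_ (Submodule g0 gP)) /=; apply=> _ [c u u' v | c u v v'];
  rewrite (linB ling) ling /g !liftU !scale1r /=.
  by rewrite (bilf.1 v) subrr.
by rewrite (bilf.2 u) subrr.
Qed.

Lemma tliftE u v : tlift f (tpure u v) = f u v.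
Proof. by rewrite /tlift (qliftE _ (@fglift_lin _ _ _) kills) liftU scale1r. Qed.

Lemma tlift_lin : linear (tlift f).
Proof. exact: qlift_lin (@fglift_lin _ _ _) kills. Qed.
End Lift.

Lemma tensor_ind (S : submodule tensor) : (forall u v, S (tpure u v)) -> forall t, S t.
Proof.
move=> Spure t; rewrite -[t]qrepK -[qrep t]freeg_sumE (lin_sum (qclass_lin _)).
elim: (dom _) => [|z s IHs]; first by rewrite big_nil; exact: submod0.
rewrite big_cons; apply: submodD => //.
case: z => u v; set a := coeff _ _.
suff -> : << a *g (u, v) >> = a *: gen u v :> free.
  by rewrite (linZ (qclass_lin _)); apply: submodZ; exact: Spure.
by apply/eqP/freeg_eqP => t'; rewrite coeffZ !coeffU mul1r.
Qed.

Lemma tensor_ext (W : lmodType K) (f g : tensor -> W) : linear f -> linear g ->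
  (forall u v, f (tpure u v) = g (tpure u v)) -> f =1 g.
Proof.
move=> linf ling fg.
have e0 : f 0 = g 0 by rewrite (lin0 linf) (lin0 ling).
have eP c x y : f x = g x -> f y = g y -> f (c *: x + y) = g (c *: x + y).
  by move=> fx fy; rewrite linf ling fx fy.
exact: (@tensor_ind (Submodule e0 eP)).
Qed.
End Tensor.
Arguments tpure {K U V} u v.
Arguments tlift {K U V W} f t.

(* Transport of homogeneous elements along an equality of degrees. *)
Definition degcast (K : fieldType) (T : nat -> lmodType K) m n (e : m = n) (x : T m) : T n :=
  eq_rect m (fun k => T k) x n e.
Arguments degcast {K T m n} e x.

Section Degcast.
Variables (K : fieldType) (T : nat -> lmodType K).

Lemma degcast_id n (e : n = n) (x : T n) : degcast e x = x.
Proof. by rewrite (eq_axiomK e). Qed.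

Lemma degcast_trans m n p (e : m = n) (e' : n = p) (x : T m) :
  degcast e' (degcast e x) = degcast (etrans e e') x.
Proof. by case: p / e'; rewrite degcast_id; congr degcast; exact: nat_irrelevance. Qed.

Lemma degcast_irr m n (e e' : m = n) (x : T m) : degcast e x = degcast e' x.
Proof. by rewrite (nat_irrelevance e e'). Qed.

Lemma degcast_lin m n (e : m = n) : linear (degcast e : T m -> T n).
Proof. by case: n / e. Qed.
End Degcast.

Record dga (K : fieldType) := Dga {
  dg_comp :> nat -> lmodType K;
  dg_mul : forall m n, dg_comp m -> dg_comp n -> dg_comp (m + n)%N;
  dg_one : dg_comp 0;
  dg_diff : forall n, dg_comp n -> dg_comp n.+1;
  dg_mul_bilinear : forall m n, bilinear_map (@dg_mul m n);
  dg_mulA : forall m n p (x : dg_comp m) (y : dg_comp n) (z : dg_comp p),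
    degcast (addnA m n p) (dg_mul x (dg_mul y z)) = dg_mul (dg_mul x y) z;
  dg_mul1l : forall n (x : dg_comp n), dg_mul dg_one x = x;
  dg_mul1r : forall n (x : dg_comp n), degcast (addn0 n) (dg_mul x dg_one) = x;
  dg_diff_linear : forall n, linear (@dg_diff n);
  dg_diff2 : forall n (x : dg_comp n), dg_diff (dg_diff x) = 0;
  dg_leibniz : forall m n (x : dg_comp m) (y : dg_comp n),
    dg_diff (dg_mul x y) =
      dg_mul (dg_diff x) y
      + (-1) ^+ m *: degcast (addnS m n) (dg_mul x (dg_diff y))
}.
Arguments dg_mul {K} d {m n}.
Arguments dg_diff {K} d {n}.

Record dga_hom (K : fieldType) (X Y : dga K) := DgaHom {
  dgh_fun :> forall n, X n -> Y n;
  dgh_linear : forall n, linear (@dgh_fun n);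
  dgh_mul : forall m n (x : X m) (y : X n),
    dgh_fun (dg_mul X x y) = dg_mul Y (dgh_fun x) (dgh_fun y);
  dgh_one : dgh_fun (dg_one X) = dg_one Y;
  dgh_diff : forall n (x : X n), dgh_fun (dg_diff X x) = dg_diff Y (dgh_fun x)
}.

Lemma dga_hom_eq (K : fieldType) (X Y : dga K) (f g : dga_hom X Y) :
  (forall n, f n =1 g n) -> f = g.
Proof.
case: f g => f f1 f2 f3 f4 [g g1 g2 g3 g4] /= fg.
have e : f = g by apply: functional_extensionality_dep => n; apply/funext/fg.
by case: g / e g1 g2 g3 g4 {fg} => *; congr DgaHom; exact: Prop_irrelevance.
Qed.

Record dg_ideal (K : fieldType) (X : dga K) := DgIdeal {
  dgi_comp :> forall n, submodule (X n);
  dgi_mull : forall m n (x : X m) (y : X n), @dgi_comp n y -> dgi_comp _ (dg_mul X x y);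
  dgi_mulr : forall m n (x : X m) (y : X n), @dgi_comp m x -> dgi_comp _ (dg_mul X x y);
  dgi_diff : forall n (x : X n), @dgi_comp n x -> dgi_comp _ (dg_diff X x)
}.

Section DgaQuotient.
Variables (K : fieldType) (X : dga K) (J : dg_ideal X).

Definition dq_comp n : lmodType K := quotm (J n).
Local Notation cl n x := (qclass (J n) x : dq_comp n).

Definition dq_mul m n (x : dq_comp m) (y : dq_comp n) : dq_comp (m + n) :=
  cl _ (dg_mul X (qrep x) (qrep y)).
Definition dq_one : dq_comp 0 := cl 0%N (dg_one X).
Definition dq_diff n (x : dq_comp n) : dq_comp n.+1 := cl n.+1 (dg_diff X (qrep x)).

Lemma dq_mulE m n (x : X m) (y : X n) : dq_mul (cl m x) (cl n y) = cl _ (dg_mul X x y).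
Proof.
apply/qclassP; set x' := qrep _; set y' := qrep _.
have Jx : J m (x' - x) by apply/qclassP; exact: qrepK.
have Jy : J n (y' - y) by apply/qclassP; exact: qrepK.
have -> : dg_mul X x' y' - dg_mul X x y =
    dg_mul X (x' - x) y' + dg_mul X x (y' - y).
  rewrite (linB ((dg_mul_bilinear X m n).1 y')) (linB ((dg_mul_bilinear X m n).2 x)).
  by rewrite addrA subrK.
by apply: submodD; [exact: dgi_mulr | exact: dgi_mull].
Qed.

Lemma dq_diffE n (x : X n) : dq_diff (cl n x) = cl n.+1 (dg_diff X x).
Proof.
apply/qclassP; rewrite -(linB (@dg_diff_linear _ X n)); apply/dgi_diff/qclassP.
exact: qrepK.
Qed.

Lemma dq_castE m n (e : m = n) (x : X m) : degcast e (cl m x) = cl n (degcast e x).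
Proof. by case: n / e. Qed.

Lemma dq_surj n (q : dq_comp n) : exists x, q = cl n x.
Proof. by exists (qrep q); rewrite qrepK. Qed.

Lemma dq_mul_bilinear m n : bilinear_map (@dq_mul m n).
Proof.
split=> [y c x x' | x c y y'].
  have [[[y0 ->] [x0 ->]] [x1 ->]] := (dq_surj y, dq_surj x, dq_surj x').
  by rewrite -qclass_lin !dq_mulE -qclass_lin ((dg_mul_bilinear X m n).1 y0).
have [[[y0 ->] [x0 ->]] [y1 ->]] := (dq_surj y, dq_surj x, dq_surj y').
by rewrite -qclass_lin !dq_mulE -qclass_lin ((dg_mul_bilinear X m n).2 x0).
Qed.

Lemma dq_mulA m n p (x : dq_comp m) (y : dq_comp n) (z : dq_comp p) :
  degcast (addnA m n p) (dq_mul x (dq_mul y z)) = dq_mul (dq_mul x y) z.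
Proof.
have [[[x0 ->] [y0 ->]] [z0 ->]] := (dq_surj x, dq_surj y, dq_surj z).
by rewrite !dq_mulE dq_castE dg_mulA.
Qed.

Lemma dq_mul1l n (x : dq_comp n) : dq_mul dq_one x = x.
Proof. by have [x0 ->] := dq_surj x; rewrite dq_mulE dg_mul1l. Qed.

Lemma dq_mul1r n (x : dq_comp n) : degcast (addn0 n) (dq_mul x dq_one) = x.
Proof. by have [x0 ->] := dq_surj x; rewrite dq_mulE dq_castE dg_mul1r. Qed.

Lemma dq_diff_linear n : linear (@dq_diff n).
Proof.
move=> c x x'; have [[x0 ->] [x1 ->]] := (dq_surj x, dq_surj x').
by rewrite -qclass_lin !dq_diffE -qclass_lin (@dg_diff_linear _ X n).
Qed.

Lemma dq_diff2 n (x : dq_comp n) : dq_diff (dq_diff x) = 0.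
Proof.
by have [x0 ->] := dq_surj x; rewrite !dq_diffE dg_diff2; exact: (lin0 (qclass_lin _)).
Qed.

Lemma dq_leibniz m n (x : dq_comp m) (y : dq_comp n) :
  dq_diff (dq_mul x y) =
    dq_mul (dq_diff x) y + (-1) ^+ m *: degcast (addnS m n) (dq_mul x (dq_diff y)).
Proof.
have [[x0 ->] [y0 ->]] := (dq_surj x, dq_surj y).
rewrite !(dq_mulE, dq_diffE) dq_castE dg_leibniz addrC.
by rewrite qclass_lin addrC.
Qed.

Definition dga_quot : dga K := Dga dq_mul_bilinear dq_mulA dq_mul1l dq_mul1r
  dq_diff_linear dq_diff2 dq_leibniz.
End DgaQuotient.

Section Junk.
Variables (K : fieldType) (X : dga K) (J0 : forall n, submodule (X n)).
Hypothesis J0_mull :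
  forall m n (x : X m) (y : X n), J0 n y -> J0 (m + n)%N (dg_mul X x y).
Hypothesis J0_mulr :
  forall m n (x : X m) (y : X n), J0 m x -> J0 (m + n)%N (dg_mul X x y).

(* d J0^(n-1), with the convention J0^(-1) = 0. *)
Definition diff_image n : X n -> Prop :=
  match n with
  | 0 => fun x => x = 0
  | m.+1 => fun x => exists2 y, J0 m y & x = dg_diff X y
  end.

Definition junk_mem n (x : X n) : Prop :=
  exists y z, [/\ J0 n y, diff_image z & x = y + z].

Lemma diff_image_lin n c (x y : X n) :
  diff_image x -> diff_image y -> diff_image (c *: x + y).
Proof.
case: n x y => [|n] x y /=; first by move=> -> ->; rewrite scaler0 addr0.
move=> [x0 Jx ->] [y0 Jy ->]; exists (c *: x0 + y0); first exact: submodP.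
by rewrite (@dg_diff_linear _ X n).
Qed.

Lemma diff_image0 n : diff_image (0 : X n).
Proof.
case: n => [|n] //; exists 0; first exact: submod0.
by rewrite (lin0 (@dg_diff_linear _ X n)).
Qed.

Lemma junk0 n : junk_mem (0 : X n).
Proof. by exists 0, 0; rewrite addr0; split=> //; [exact: submod0 | exact: diff_image0]. Qed.

Lemma junkP n c (x y : X n) : junk_mem x -> junk_mem y -> junk_mem (c *: x + y).
Proof.
move=> [x0 [x1 [Jx dx ->]]] [y0 [y1 [Jy dy ->]]].
exists (c *: x0 + y0), (c *: x1 + y1); split; first exact: submodP.
  exact: diff_image_lin.
by rewrite scalerDr addrACA.
Qed.

Definition junk_submod n : submodule (X n) := Submodule (@junk0 n) (@junkP n).

Lemma J0_junk n x : J0 n x -> junk_submod n x.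
Proof. by move=> Jx; exists x, 0; rewrite addr0; split=> //; exact: diff_image0. Qed.

Lemma dJ0_junk n x : J0 n x -> junk_submod n.+1 (dg_diff X x).
Proof.
by move=> Jx; exists 0, (dg_diff X x); rewrite add0r; split=> //;
  [exact: submod0 | exists x].
Qed.

Lemma junk_cast m n (e : m = n) (x : X m) :
  junk_submod n (degcast e x) -> junk_submod m x.
Proof. by case: n / e. Qed.

Lemma J0_cast m n (e : m = n) (x : X m) : J0 m x -> J0 n (degcast e x).
Proof. by case: n / e. Qed.

Lemma junk_mull m n (x : X m) (y : X n) :
  junk_submod n y -> junk_submod (m + n)%N (dg_mul X x y).
Proof.
move=> [y0 [y1 [Jy dy ->]]].
rewrite (linD ((dg_mul_bilinear X m n).2 x)); apply: submodD.
  by apply: J0_junk; exact: J0_mull.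
case: n y y0 y1 Jy dy => [|n] _ _ y1 _ /=.
  by move=> ->; rewrite (lin0 ((dg_mul_bilinear X m 0).2 x)); exact: (submod0 (junk_submod _)).
move=> [z Jz ->]; apply: (@junk_cast _ _ (addnS m n)).
have /(congr1 (fun t => (-1) ^+ m *: (t - dg_mul X (dg_diff X x) z))) :=
  dg_leibniz x z.
rewrite addrAC subrr add0r scalerA -expr2 sqrr_sign scale1r => <-.
apply: submodZ; apply: submodB; first by apply: dJ0_junk; exact: J0_mull.
by apply: J0_junk; exact: J0_mull.
Qed.

Lemma junk_mulr m n (x : X m) (y : X n) :
  junk_submod m x -> junk_submod (m + n)%N (dg_mul X x y).
Proof.
move=> [x0 [x1 [Jx dx ->]]].
rewrite (linD ((dg_mul_bilinear X m n).1 y)); apply: submodD.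
  by apply: J0_junk; exact: J0_mulr.
case: m x x0 x1 Jx dx => [|m] _ _ x1 _ /=.
  by move=> ->; rewrite (lin0 ((dg_mul_bilinear X 0 n).1 y)); exact: (submod0 (junk_submod _)).
move=> [z Jz ->]; have /eqP := dg_leibniz z y; rewrite -subr_eq => /eqP <-.
apply: (@submodB _ _ (junk_submod _)); first by apply: dJ0_junk; exact: J0_mulr.
by apply: (@submodZ _ _ (junk_submod _)); apply: J0_junk; apply: J0_cast; exact: J0_mulr.
Qed.

Lemma junk_diff n (x : X n) : junk_submod n x -> junk_submod n.+1 (dg_diff X x).
Proof.
move=> [y [z [Jy dz ->]]]; rewrite (linD (@dg_diff_linear _ X n)); apply: submodD.
  exact: dJ0_junk.
case: n x z {y Jy} dz => [|n] _ z /=.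
  by move=> ->; rewrite (lin0 (@dg_diff_linear _ X 0)); exact: (submod0 (junk_submod _)).
by move=> [t _ ->]; rewrite dg_diff2; exact: (submod0 (junk_submod _)).
Qed.

Definition junk_ideal : dg_ideal X := DgIdeal junk_mull junk_mulr junk_diff.
End Junk.

(* Unital associative K-algebras; algType would exclude the zero algebra. *)
Record algebra (K : fieldType) := Algebra {
  alg_space :> lmodType K;
  alg_mul : alg_space -> alg_space -> alg_space;
  alg_one : alg_space;
  alg_mul_bilinear : bilinear_map alg_mul;
  alg_mulA : associative alg_mul;
  alg_mul1l : left_id alg_one alg_mul;
  alg_mul1r : right_id alg_one alg_mul
}.
Arguments alg_mul {K a} : rename.
Arguments alg_one {K a} : rename.
Local Notation "a ** b" := (alg_mul a b) (at level 40, left associativity).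
Local Notation "\1" := alg_one.

Section AlgebraOfAlgType.
Variables (K : fieldType) (A : algType K).

Lemma algType_mul_bilinear : bilinear_map ( *%R : A -> A -> A).
Proof.
by split=> [b c x y | a c x y] /=; [rewrite mulrDl -scalerAl | rewrite mulrDr -scalerAr].
Qed.

Definition algebra_of_algType : algebra K :=
  Algebra algType_mul_bilinear (@mulrA A) (@mul1r A) (@mulr1 A).
End AlgebraOfAlgType.

Section UniversalForms.
Variables (K : fieldType) (A : algebra K).
Implicit Types a b c : A.

Definition is_scalar a := exists c : K, a = c *: \1.
Lemma is_scalar0 : is_scalar 0. Proof. by exists 0; rewrite scale0r. Qed.
Lemma is_scalarP (t : K) a b : is_scalar a -> is_scalar b -> is_scalar (t *: a + b).
Proof. by move=> [u ->] [v ->]; exists (t * u + v); rewrite scalerDl scalerA. Qed.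
Definition scalars : submodule A := Submodule is_scalar0 is_scalarP.

Definition redalg : lmodType K := quotm scalars.
Definition bar a : redalg := qclass scalars a.

(* A (x) Abar (x) ... (x) Abar, nested to the left: w da is the pure tensor
   of w and bar a. *)
Fixpoint forms (n : nat) : lmodType K :=
  match n with
  | 0 => A
  | m.+1 => tensor (forms m) redalg
  end.

Definition wedge_d n (w : forms n) a : forms n.+1 := tpure w (bar a).

(* a_0 da_1 ... da_n; only a 0, ..., a n matter. *)
Fixpoint monom (n : nat) (a : nat -> A) : forms n :=
  match n with
  | 0 => a 0%N
  | m.+1 => wedge_d (monom m a) (a m.+1)
  end.

(* d a = 1 da and d (w da) = (d w) da. *)
Fixpoint form_d (n : nat) : forms n -> forms n.+1 :=
  match n with
  | 0 => fun a => wedge_d (\1 : forms 0) a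
  | m.+1 => tlift (fun w abar => tpure (form_d w) abar)
  end.

(* The right A-module structure: (w da) b = w d(ab) - (w a) db. *)
Fixpoint form_mulr (n : nat) : forms n -> A -> forms n :=
  match n with
  | 0 => fun a b => (a : A) ** b
  | m.+1 => fun x b =>
      tlift (fun w => qlift (fun a => wedge_d w (a ** b) - wedge_d (form_mulr w a) b)) x
  end.

(* x (y db) = (x y) db. *)
Fixpoint form_mul_rev (m n : nat) (x : forms m) : forms n -> forms (n + m) :=
  match n with
  | 0 => fun b => form_mulr x b
  | p.+1 => tlift (fun y bbar => tpure (form_mul_rev x y) bbar)
  end.

Definition form_mul m n (x : forms m) (y : forms n) : forms (m + n) :=
  degcast (addnC n m) (form_mul_rev x y).

Lemma bar_lin : linear bar. Proof. exact: qclass_lin. Qed.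

Lemma bar1 : bar \1 = 0.
Proof. by apply/qclass0; exists 1; rewrite scale1r. Qed.

Lemma wedge_d_bilinear n : bilinear_map (@wedge_d n).
Proof.
split=> [a t w w' | w t a b]; rewrite /wedge_d; first exact: (tpure_bilin _ _).1.
by rewrite bar_lin (tpure_bilin _ _).2.
Qed.
Let wl n a := (@wedge_d_bilinear n).1 a.
Let wr n w := (@wedge_d_bilinear n).2 w.

Lemma wedge_d1 n (w : forms n) : wedge_d w \1 = 0.
Proof. by rewrite /wedge_d bar1 (lin0 ((tpure_bilin _ _).2 w)). Qed.

Lemma form_ext n (W : lmodType K) (f g : forms n.+1 -> W) : linear f -> linear g ->
  (forall w a, f (wedge_d w a) = g (wedge_d w a)) -> f =1 g.
Proof. by move=> lf lg fg; apply: tensor_ext => // w q; rewrite -[q]qrepK; exact: fg. Qed.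

(* Maps out of forms n.+1 given by a bilinear map vanishing on scalars. *)
Section FormLift.
Variables (n : nat) (W : lmodType K) (f : forms n -> A -> W).
Hypotheses (bilf : bilinear_map f) (f1 : forall w, f w \1 = 0).
Let F : forms n.+1 -> W := tlift (fun w => qlift (f w)).

Let f_scalar w s : scalars s -> f w s = 0.
Proof. by move=> [c ->]; rewrite (linZ (bilf.2 w)) f1 scaler0. Qed.

Let bilF : bilinear_map (fun w => qlift (f w) : redalg -> W).
Proof.
split=> [q c w w' | w]; last exact: (qlift_lin (bilf.2 w) (@f_scalar w)).
exact: (bilf.1 _).
Qed.

Lemma form_liftE w a : F (wedge_d w a) = f w a.
Proof. by rewrite /F (tliftE bilF) (qliftE _ (bilf.2 w) (@f_scalar w)). Qed.

Lemma form_lift_lin : linear F. Proof. exact: (tlift_lin bilF). Qed.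
End FormLift.

Lemma form_d_lin n : linear (@form_d n).
Proof.
elim: n => [|n IHn]; first exact: (@wr 0%N \1).
have bil : bilinear_map (fun w (abar : redalg) => tpure (@form_d n w) abar).
  split=> [q c w w' | w c q q']; first by rewrite IHn (tpure_bilin _ _).1.
  exact: (tpure_bilin _ _).2.
exact: (tlift_lin bil).
Qed.

Lemma form_dE n (w : forms n) a : form_d (wedge_d w a) = wedge_d (form_d w) a.
Proof.
have bil : bilinear_map (fun v (abar : redalg) => tpure (@form_d n v) abar).
  split=> [q c v v' | v c q q']; first by rewrite form_d_lin (tpure_bilin _ _).1.
  exact: (tpure_bilin _ _).2.
exact: (tliftE bil).
Qed.

Lemma form_d2 n (w : forms n) : form_d (form_d w) = 0.
Proof.
elim: n w => [|n IHn] w.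
  rewrite [form_d w]/= form_dE.
  by rewrite [form_d _]/= wedge_d1 (lin0 (wl _)).
move: w; apply: form_ext => [c x y | c x y | w a].
- by rewrite !form_d_lin.
- by rewrite scaler0 addr0.
by rewrite !form_dE IHn (lin0 (wl _)).
Qed.

Lemma form_mulr_props n :
  bilinear_map (@form_mulr n) /\ (forall w, @form_mulr n w \1 = w).
Proof.
elim: n => [|n [[IHl IHr] IH1]] /=.
  by split; [exact: alg_mul_bilinear | exact: alg_mul1r].
pose f b w a := wedge_d w (a ** b) - wedge_d (@form_mulr n w a) b.
have bilf b : bilinear_map (f b).
  split=> [a c w w' | w c a a']; rewrite /f /=.
    by rewrite IHl !wl scalerBr opprD addrACA.
  by rewrite (alg_mul_bilinear A).1 wr IHr wl scalerBr opprD addrACA.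
have f1 b w : f b w \1 = 0 by rewrite /f alg_mul1l IH1 subrr.
split; first split=> [b | x c b b'].
- exact: (form_lift_lin (bilf b) (f1 b)).
- move: x; apply: (form_ext (n := n)) => [t x y | t x y | w a].
  + exact: (form_lift_lin (bilf _) (f1 _)).
  + exact: (lin_comb c (form_lift_lin (bilf b) (f1 b)) (form_lift_lin (bilf b') (f1 b'))).
  have fb : f (c *: b + b') w a = c *: f b w a + f b' w a.
    by rewrite /f (alg_mul_bilinear A).2 !wr scalerBr opprD addrACA.
  rewrite !(form_liftE (bilf _) (f1 _)); exact: fb.
apply: (form_ext (n := n)) => [||w a].
- exact: (form_lift_lin (bilf _) (f1 _)).
- by [].
by rewrite (form_liftE (bilf _) (f1 _)) /f alg_mul1r wedge_d1 subr0.
Qed.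

Lemma form_mulr_bilinear n : bilinear_map (@form_mulr n).
Proof. by have [] := form_mulr_props n. Qed.
Let ml n b := (@form_mulr_bilinear n).1 b.
Let mr n w := (@form_mulr_bilinear n).2 w.

Lemma form_mulr1 n (w : forms n) : form_mulr w \1 = w.
Proof. by have [_] := form_mulr_props n; apply. Qed.

Lemma form_mulrE n (w : forms n) a b :
  form_mulr (wedge_d w a) b = wedge_d w (a ** b) - wedge_d (form_mulr w a) b.
Proof.
pose f w a := wedge_d w (a ** b) - wedge_d (@form_mulr n w a) b.
apply: (form_liftE (f := f)); last by move=> w'; rewrite /f alg_mul1l form_mulr1 subrr.
split=> [a' c w' w2 | w' c a' a2]; rewrite /f /=.
  by rewrite ml !wl scalerBr opprD addrACA.
by rewrite (alg_mul_bilinear A).1 wr mr wl scalerBr opprD addrACA.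
Qed.

Lemma form_mulrA n (w : forms n) a b : form_mulr (form_mulr w a) b = form_mulr w (a ** b).
Proof.
elim: n w a b => [|n IHn] w a b; first by rewrite /= alg_mulA.
move: w; apply: form_ext => [c x y | c x y | w a'].
- by rewrite !ml.
- by rewrite !ml.
rewrite !form_mulrE (linB (ml _)) !form_mulrE IHn alg_mulA.
by rewrite opprB addrA subrK.
Qed.

Lemma form_mul_rev_bilinear m n : bilinear_map (@form_mul_rev m n).
Proof.
elim: n => [|n [IHl IHr]] /=; first exact: form_mulr_bilinear.
have bil x : bilinear_map (fun y (bbar : redalg) => tpure (@form_mul_rev m n x y) bbar).
  split=> [q c y y' | y c q q']; first by rewrite IHr (tpure_bilin _ _).1.
  exact: (tpure_bilin _ _).2.
split=> [y c x x' | x]; last exact: (tlift_lin (bil x)).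
move: y; apply: tensor_ext => [|t y y'|y q].
- exact: (tlift_lin (bil _)).
- exact: (lin_comb c (tlift_lin (bil x)) (tlift_lin (bil x'))).
by rewrite !(tliftE (bil _)) IHl (tpure_bilin _ _).1.
Qed.
Let rl m n y := (@form_mul_rev_bilinear m n).1 y.
Let rr m n x := (@form_mul_rev_bilinear m n).2 x.

Lemma form_mul_revE m n (x : forms m) (y : forms n) b :
  form_mul_rev x (wedge_d y b) = wedge_d (form_mul_rev x y) b.
Proof.
have bil : bilinear_map (fun v (bbar : redalg) => tpure (@form_mul_rev m n x v) bbar).
  split=> [q c v v' | v c q q']; first by rewrite rr (tpure_bilin _ _).1.
  exact: (tpure_bilin _ _).2.
exact: (tliftE bil).
Qed.

Lemma wedge_d_cast m n (e : m = n) (e' : m.+1 = n.+1) (w : forms m) a :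
  wedge_d (degcast e w) a = degcast e' (wedge_d w a).
Proof. by case: n / e e' => e'; rewrite !degcast_id. Qed.

Lemma form_d_cast m n (e : m = n) (e' : m.+1 = n.+1) (w : forms m) :
  form_d (degcast e w) = degcast e' (form_d w).
Proof. by case: n / e e' => e'; rewrite !degcast_id. Qed.

Lemma form_mul_rev_mulr m n (x : forms m) (y : forms n) b :
  form_mulr (form_mul_rev x y) b = form_mul_rev x (form_mulr y b).
Proof.
elim: n y b => [|n IHn] y b; first exact: form_mulrA.
move: y; apply: form_ext => [c y y' | c y y' | y a].
- by rewrite rr ml.
- by rewrite ml rr.
by rewrite form_mul_revE !form_mulrE (linB (rr _)) !form_mul_revE IHn.
Qed.

Lemma form_mul_revA m n p (x : forms m) (y : forms n) (z : forms p) :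
  degcast (addnA p n m) (form_mul_rev (form_mul_rev x y) z) =
  form_mul_rev x (form_mul_rev y z).
Proof.
elim: p z => [|p IHp] z; first by rewrite degcast_id; exact: form_mul_rev_mulr.
move: z; apply: form_ext => [c z z' | c z z' | z a].
- by rewrite rr degcast_lin.
- by rewrite !rr.
rewrite !form_mul_revE -IHp; symmetry; exact: wedge_d_cast.
Qed.

Lemma form_mul_rev1l n (y : forms n) :
  form_mul_rev (\1 : forms 0) y = degcast (esym (addn0 n)) y.
Proof.
elim: n y => [|n IHn] y; first by rewrite degcast_id; exact: alg_mul1l.
move: y; apply: form_ext => [c y y' | c y y' | y b].
- by rewrite rr.
- by rewrite degcast_lin.
rewrite form_mul_revE IHn; exact: wedge_d_cast.
Qed.

Lemma form_leibniz_rev m n (x : forms m) (y : forms n) :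
  form_d (form_mul_rev x y) =
    degcast (addnS n m) (form_mul_rev (form_d x) y)
    + (-1) ^+ m *: form_mul_rev x (form_d y).
Proof.
elim: n y => [|n IHn] y; last first.
  move: y; apply: form_ext => [c y y' | | y b].
  - by rewrite rr form_d_lin.
  - have -> : (fun y : forms n.+1 =>
        degcast (addnS n.+1 m) (form_mul_rev (form_d x) y)
        + (-1) ^+ m *: form_mul_rev x (form_d y)) =
      (fun y => (-1) ^+ m *: form_mul_rev x (form_d y) +
        degcast (addnS n.+1 m) (form_mul_rev (form_d x) y)).
      by apply/funext => y; rewrite addrC.
    apply: lin_comb => c y y'; first by rewrite form_d_lin rr.
    by rewrite rr degcast_lin.
  rewrite form_mul_revE !form_dE form_mul_revE IHn addrC wl addrC.
  by rewrite (wedge_d_cast _ (addnS n.+1 m)) form_mul_revE.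
have -> : form_mul_rev x (form_d (y : forms 0)) = wedge_d x y.
  by rewrite [form_d y]/= form_mul_revE; congr wedge_d; exact: form_mulr1.
rewrite degcast_id.
change (form_d (form_mulr x y) = form_mulr (form_d x) y + (-1) ^+ m *: wedge_d x y).
elim: m x y => [|m IHm] x y.
  change (wedge_d (\1 : forms 0) (x ** y) =
    form_mulr (wedge_d (\1 : forms 0) x) y + 1 *: wedge_d x y).
  have e : form_mulr (\1 : forms 0) x = x by exact: alg_mul1l.
  by rewrite form_mulrE e scale1r subrK.
move: x; apply: form_ext => [c x x' | | x a].
- by rewrite ml form_d_lin.
- have -> : (fun x : forms m.+1 =>
      form_mulr (form_d x) y + (-1) ^+ m.+1 *: wedge_d x y) =
    (fun x => (-1) ^+ m.+1 *: wedge_d x y + form_mulr (form_d x) y).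
    by apply/funext => x; rewrite addrC.
  apply: lin_comb => c x x'; first by rewrite wl.
  by rewrite form_d_lin ml.
rewrite form_mulrE (linB (@form_d_lin _)) !form_dE form_mulrE IHm.
rewrite [form_mulr _ _ + _]addrC wl exprS mulN1r scaleNr.
by rewrite opprD [- _ - _]addrC addrA.
Qed.

Lemma form_mul_rev_castr m n p (e : n = p) (e' : (n + m = p + m)%N)
    (x : forms m) (y : forms n) :
  form_mul_rev x (degcast e y) = degcast e' (form_mul_rev x y).
Proof. by case: p / e e' => e'; rewrite !degcast_id. Qed.

Lemma form_mul_rev_castl m n p (e : m = p) (e' : (n + m = n + p)%N)
    (x : forms m) (y : forms n) :
  form_mul_rev (degcast e x) y = degcast e' (form_mul_rev x y).
Proof. by case: p / e e' => e'; rewrite !degcast_id. Qed.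

Lemma form_mul_bilinear m n : bilinear_map (@form_mul m n).
Proof.
by split=> [y c x x' | x c y y']; rewrite /form_mul ?rl ?rr degcast_lin.
Qed.

Lemma form_mulA m n p (x : forms m) (y : forms n) (z : forms p) :
  degcast (addnA m n p) (form_mul x (form_mul y z)) = form_mul (form_mul x y) z.
Proof.
rewrite /form_mul.
rewrite (form_mul_rev_castr _ (congr1 (addn^~ m) (addnC p n))).
rewrite (form_mul_rev_castl _ (congr1 (addn p) (addnC n m))).
by rewrite -form_mul_revA !degcast_trans; exact: degcast_irr.
Qed.

Lemma form_mul1l n (x : forms n) : form_mul (\1 : forms 0) x = x.
Proof. by rewrite /form_mul form_mul_rev1l degcast_trans degcast_id. Qed.

Lemma form_mulx1 n (x : forms n) :
  degcast (addn0 n) (form_mul x (\1 : forms 0)) = x.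
Proof.
rewrite /form_mul degcast_trans.
by have := form_mulr1 x; rewrite degcast_id.
Qed.

Lemma form_leibniz m n (x : forms m) (y : forms n) :
  form_d (form_mul x y) =
    form_mul (form_d x) y + (-1) ^+ m *: degcast (addnS m n) (form_mul x (form_d y)).
Proof.
rewrite /form_mul (form_d_cast _ (congr1 S (addnC n m))) form_leibniz_rev.
rewrite addrC degcast_lin addrC !degcast_trans.
by congr (_ + _ *: _); exact: degcast_irr.
Qed.

Definition universal_dga : dga K := Dga form_mul_bilinear form_mulA form_mul1l
  form_mulx1 form_d_lin form_d2 form_leibniz.
End UniversalForms.

Record spectral_triple (K : fieldType) := SpectralTriple {
  st_alg : algebra K;
  st_space : lmodType K;
  st_rep : st_alg -> {linear st_space -> st_space};
  st_D : {linear st_space -> st_space};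
  st_gamma : {linear st_space -> st_space};
  st_rep_linear : forall (c : K) (a b : st_alg) (v : st_space),
    st_rep (c *: a + b) v = c *: st_rep a v + st_rep b v;
  st_rep_mul : forall (a b : st_alg) v, st_rep (a ** b) v = st_rep a (st_rep b v);
  st_rep_one : forall v, st_rep \1 v = v;
  st_gamma2 : forall v, st_gamma (st_gamma v) = v;
  st_gamma_rep : forall a v, st_gamma (st_rep a v) = st_rep a (st_gamma v);
  st_gamma_D : forall v, st_gamma (st_D v) = - st_D (st_gamma v)
}.
Arguments st_alg {K} s.
Arguments st_space {K} s.
Arguments st_rep {K s} a.
Arguments st_D {K} s.
Arguments st_gamma {K} s.

Record spectral_hom (K : fieldType) (X Y : spectral_triple K) := SpectralHom {
  sh_alg : st_alg X -> st_alg Y;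
  sh_space : st_space X -> st_space Y;
  sh_alg_linear : linear sh_alg;
  sh_alg_mul : {morph sh_alg : a b / a ** b};
  sh_alg_one : sh_alg \1 = \1;
  sh_space_linear : linear sh_space;
  sh_space_surj : forall w, exists v, sh_space v = w;
  sh_D : forall v, sh_space (st_D X v) = st_D Y (sh_space v);
  sh_gamma : forall v, sh_space (st_gamma X v) = st_gamma Y (sh_space v);
  sh_rep : forall a v, sh_space (st_rep a v) = st_rep (sh_alg a) (sh_space v)
}.

Lemma spectral_hom_eq (K : fieldType) (X Y : spectral_triple K) (f g : spectral_hom X Y) :
  sh_alg f =1 sh_alg g -> sh_space f =1 sh_space g -> f = g.
Proof.
case: f => fa fs f1 f2 f3 f4 f5 f6 f7 f8; case: g => ga gs g1 g2 g3 g4 g5 g6 g7 g8 /=.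
move=> /funext ea /funext es; case: ga / ea g1 g2 g3 g8 => g1 g2 g3.
case: gs / es g4 g5 g6 g7 => g4 g5 g6 g7 g8.
by congr SpectralHom; exact: Prop_irrelevance.
Qed.

Section ConnesForms.
Variables (K : fieldType) (X : spectral_triple K).
Local Notation A := (st_alg X).
Local Notation V := (st_space X).
Local Notation op := (V -> V : lmodType K).

(* [D, a] *)
Definition commD (a : A) (v : V) : V := st_D X (st_rep a v) - st_rep a (st_D X v).

(* pi (a_0 da_1 ... da_n) = a_0 [D, a_1] ... [D, a_n] *)
Fixpoint form_rep (n : nat) : forms A n -> V -> V :=
  match n with
  | 0 => fun a => st_rep (a : A)
  | m.+1 => @tlift K (forms A m) (redalg A) op
      (fun w => qlift (fun a => form_rep w \o commD a))
  end.

(* a_0 [D, a_1] ... [D, a_n] *)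
Fixpoint opword (n : nat) (a : nat -> A) : V -> V :=
  match n with
  | 0 => st_rep (a 0%N)
  | m.+1 => opword m a \o commD (a m.+1)
  end.

Lemma commD_linear a : linear (commD a).
Proof.
move=> c u v; rewrite /commD (linearP (st_rep a)) !(linearP (st_D X)) (linearP (st_rep a)).
by rewrite scalerBr opprD addrACA.
Qed.

Lemma commDP c a b v : commD (c *: a + b) v = c *: commD a v + commD b v.
Proof.
by rewrite /commD !st_rep_linear (linearP (st_D X)) scalerBr opprD addrACA.
Qed.

Lemma commD1 v : commD \1 v = 0.
Proof. by rewrite /commD !st_rep_one subrr. Qed.

Lemma commDM a b v : commD (a ** b) v = commD a (st_rep b v) + st_rep a (commD b v).
Proof. by rewrite /commD !st_rep_mul linearB addrA subrK. Qed.

Lemma form_rep_props n :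
  linear (@form_rep n : forms A n -> op) /\ (forall w, linear (@form_rep n w)).
Proof.
elim: n => [|n [IHl IHv]].
  split=> [c a b|a]; last exact: linearP.
  by apply/funext => v; exact: st_rep_linear.
pose f (w : forms A n) (a : A) : op := @form_rep n w \o commD a.
have bilf : bilinear_map f.
  split=> [a c w w' | w c a a']; apply/funext => v; rewrite /f /=.
    by rewrite IHl.
  by rewrite commDP IHv.
have f1 w : f w \1 = 0.
  by apply/funext => v; rewrite /f /= commD1 (lin0 (IHv w)).
have linf : linear (@form_rep n.+1 : forms A n.+1 -> op).
  exact: (form_lift_lin bilf f1).
split=> [|w]; first exact: linf.
pose S (x : forms A n.+1) := linear (@form_rep n.+1 x).
have S0 : S 0 by move=> c u v; rewrite (lin0 linf) /= scaler0 addr0.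
have SP c x y : S x -> S y -> S (c *: x + y).
  by move=> Sx Sy t u v; rewrite linf; exact: (lin_comb c Sx Sy).
apply: (@tensor_ind _ _ _ (Submodule S0 SP)) => u q; rewrite -[q]qrepK.
have E : @form_rep n.+1 (wedge_d u (qrep q)) = f u (qrep q).
  exact: (form_liftE bilf f1).
change (S (wedge_d u (qrep q))); rewrite /S E => t v v'; rewrite /f /= commD_linear.
exact: IHv.
Qed.

Lemma form_rep_lin n : linear (@form_rep n : forms A n -> op).
Proof. by have [] := form_rep_props n. Qed.

Lemma form_rep_oplin n (w : forms A n) : linear (form_rep w).
Proof. by have [_] := form_rep_props n; apply. Qed.

Lemma form_repE n (w : forms A n) a : form_rep (wedge_d w a) = form_rep w \o commD a.
Proof.
apply: (form_liftE (W := op) (f := fun w a => form_rep w \o commD a)).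
  split=> [b c x x' | x c b b']; apply/funext => v /=; first by rewrite form_rep_lin.
  by rewrite commDP form_rep_oplin.
by move=> x; apply/funext => v /=; rewrite commD1 (lin0 (form_rep_oplin x)).
Qed.

Lemma form_rep_monom n a : form_rep (monom n a) = opword n a.
Proof. by elim: n => [|n IHn] //; rewrite form_repE IHn. Qed.

Lemma form_rep_mulr n (w : forms A n) a v :
  form_rep (form_mulr w a) v = form_rep w (st_rep a v).
Proof.
elim: n w a v => [|n IHn] w a v; first exact: st_rep_mul.
move: w; apply: form_ext => [c x y | c x y | w b].
- by rewrite (form_mulr_bilinear _ _).1 form_rep_lin.
- by rewrite form_rep_lin.
rewrite form_mulrE (linB (@form_rep_lin _)) !form_repE.
rewrite addrfctE opprfctE /=.
by rewrite IHn commDM (linD (form_rep_oplin w)) addrK.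
Qed.

Lemma form_rep_mul_rev m n (x : forms A m) (y : forms A n) v :
  form_rep (form_mul_rev x y) v = form_rep x (form_rep y v).
Proof.
elim: n y v => [|n IHn] y v; first exact: form_rep_mulr.
move: y; apply: form_ext => [c y y' | c y y' | y b].
- by rewrite (form_mul_rev_bilinear _ _ _).2 form_rep_lin.
- by rewrite form_rep_lin -form_rep_oplin.
by rewrite form_mul_revE !form_repE /= IHn.
Qed.

Lemma form_rep_cast m n (e : m = n) (x : forms A m) :
  form_rep (degcast e x) = form_rep x.
Proof. by case: n / e. Qed.

Lemma form_rep_mul m n (x : forms A m) (y : forms A n) :
  form_rep (form_mul x y) = form_rep x \o form_rep y.
Proof. by apply/funext => v; rewrite form_rep_cast form_rep_mul_rev. Qed.

Definition J0_mem n (w : forms A n) := form_rep w = 0 :> op.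
Lemma J0_0 n : J0_mem (0 : forms A n). Proof. exact: (lin0 (@form_rep_lin n)). Qed.
Lemma J0_P n c (x y : forms A n) : J0_mem x -> J0_mem y -> J0_mem (c *: x + y).
Proof. by rewrite /J0_mem form_rep_lin => -> ->; rewrite scaler0 addr0. Qed.
Definition J0 n : submodule (universal_dga A n) := Submodule (@J0_0 n) (@J0_P n).

Lemma J0_mull m n (x : universal_dga A m) (y : universal_dga A n) :
  J0 n y -> J0 (m + n)%N (dg_mul _ x y).
Proof.
rewrite /J0 /= /J0_mem form_rep_mul => ->.
by apply/funext => v /=; exact: (lin0 (form_rep_oplin x)).
Qed.

Lemma J0_mulr m n (x : universal_dga A m) (y : universal_dga A n) :
  J0 m x -> J0 (m + n)%N (dg_mul _ x y).
Proof. by rewrite /J0 /= /J0_mem form_rep_mul => ->. Qed.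

(* J^n = J_0^n + d J_0^(n-1) *)
Definition J : dg_ideal (universal_dga A) := junk_ideal J0_mull J0_mulr.

Definition Omega_D : dga K := dga_quot J.

(* [T], for T in pi(Omega^n): the class of the forms represented by T. It does
   not depend on the chosen representative, see opclassE. *)
Definition opclass n (T : V -> V) : Omega_D n :=
  qclass (J n) (xget 0 [set w | form_rep w = T]).

Lemma opclassE n (w : universal_dga A n) : opclass n (form_rep w) = qclass (J n) w.
Proof.
apply/qclassP/J0_junk; set w' := xget _ _.
have ew : form_rep w' = form_rep w.
  by apply: (@xgetPex (universal_dga A n) 0 (fun x => form_rep x = form_rep w)); exists w.
by rewrite /J0 /= /J0_mem (linB (@form_rep_lin n)) ew subrr.
Qed.

Lemma opclass_opword n r (a : 'I_r -> nat -> A) :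
  opclass n (\sum_(j < r) (opword n (a j) : op)) = \sum_(j < r) opclass n (opword n (a j)).
Proof.
have -> : \sum_(j < r) (opword n (a j) : op) =
    form_rep (\sum_(j < r) monom n (a j)).
  by rewrite (lin_sum (@form_rep_lin n)); apply: eq_bigr => j _; rewrite form_rep_monom.
rewrite opclassE (lin_sum (qclass_lin (J n))).
by apply: eq_bigr => j _; rewrite -form_rep_monom opclassE.
Qed.
End ConnesForms.

Record category := Category {
  cat_obj :> Type;
  cat_hom : cat_obj -> cat_obj -> Type;
  cat_id : forall X, cat_hom X X;
  cat_comp : forall X Y Z, cat_hom Y Z -> cat_hom X Y -> cat_hom X Z;
  cat_idl : forall X Y (f : cat_hom X Y), cat_comp (cat_id Y) f = f;
  cat_idr : forall X Y (f : cat_hom X Y), cat_comp f (cat_id X) = f;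
  cat_compA : forall X Y Z T (h : cat_hom Z T) (g : cat_hom Y Z) (f : cat_hom X Y),
    cat_comp h (cat_comp g f) = cat_comp (cat_comp h g) f
}.
Arguments cat_hom {c} X Y : rename.
Arguments cat_id {c} X : rename.
Arguments cat_comp {c X Y Z} g f : rename.

Definition is_functor (C E : category) (F0 : C -> E)
    (F1 : forall X Y, cat_hom X Y -> cat_hom (F0 X) (F0 Y)) : Prop :=
  (forall X, F1 X X (cat_id X) = cat_id (F0 X)) /\
  (forall X Y Z (g : cat_hom Y Z) (f : cat_hom X Y),
    F1 X Z (cat_comp g f) = cat_comp (F1 Y Z g) (F1 X Y f)).

Section SpecCategory.
Variable K : fieldType.
Implicit Types X Y Z : spectral_triple K.

Definition spectral_id X : spectral_hom X X.
Proof. by apply: (@SpectralHom K X X id id) => // w; exists w. Defined.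

Definition spectral_comp X Y Z (g : spectral_hom Y Z) (f : spectral_hom X Y) :
  spectral_hom X Z.
Proof.
apply: (@SpectralHom K X Z (sh_alg g \o sh_alg f) (sh_space g \o sh_space f)).
- by move=> c a b /=; rewrite sh_alg_linear sh_alg_linear.
- by move=> a b /=; rewrite !sh_alg_mul.
- by rewrite /= !sh_alg_one.
- by move=> c v w /=; rewrite !sh_space_linear.
- by move=> w; have [u <-] := sh_space_surj g w; have [v <-] := sh_space_surj f u; exists v.
- by move=> v /=; rewrite !sh_D.
- by move=> v /=; rewrite !sh_gamma.
- by move=> a v /=; rewrite !sh_rep.
Defined.

Lemma spectral_idl X Y (f : spectral_hom X Y) : spectral_comp (spectral_id Y) f = f.
Proof. exact: spectral_hom_eq. Qed.

Lemma spectral_idr X Y (f : spectral_hom X Y) : spectral_comp f (spectral_id X) = f.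
Proof. exact: spectral_hom_eq. Qed.

Lemma spectral_compA X Y Z T (h : spectral_hom Z T) (g : spectral_hom Y Z)
    (f : spectral_hom X Y) :
  spectral_comp h (spectral_comp g f) = spectral_comp (spectral_comp h g) f.
Proof. exact: spectral_hom_eq. Qed.

Definition SpecTilde : category := Category spectral_idl spectral_idr spectral_compA.
End SpecCategory.

Section DgaCategory.
Variable K : fieldType.
Implicit Types X Y Z : dga K.

Definition dga_id X : dga_hom X X.
Proof. exact: (@DgaHom K X X (fun n => id)). Defined.

Definition dga_comp X Y Z (g : dga_hom Y Z) (f : dga_hom X Y) : dga_hom X Z.
Proof.
apply: (@DgaHom K X Z (fun n => g n \o f n)).
- by move=> n c x y /=; rewrite !dgh_linear.
- by move=> m n x y /=; rewrite !dgh_mul.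
- by rewrite /= !dgh_one.
- by move=> n x /=; rewrite !dgh_diff.
Defined.

Lemma dga_idl X Y (f : dga_hom X Y) : dga_comp (dga_id Y) f = f.
Proof. exact: dga_hom_eq. Qed.

Lemma dga_idr X Y (f : dga_hom X Y) : dga_comp f (dga_id X) = f.
Proof. exact: dga_hom_eq. Qed.

Lemma dga_compA X Y Z T (h : dga_hom Z T) (g : dga_hom Y Z) (f : dga_hom X Y) :
  dga_comp h (dga_comp g f) = dga_comp (dga_comp h g) f.
Proof. exact: dga_hom_eq. Qed.

Definition DGA : category := Category dga_idl dga_idr dga_compA.
End DgaCategory.

(* Main.v *)
(** The algebra morphism phi extends to a morphism of universal dgas
    a_0 da_1 ... da_n |-> phi(a_0) dphi(a_1) ... dphi(a_n), which satisfies
    Phi o pi_1(w) = pi_2(phi(w)) o Phi.  Since Phi is surjective, pi_1(w) = 0 forces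
    pi_2(phi(w)) = 0; hence J_0 is mapped into J_0, J into J, and the morphism
    descends to the quotients. *)

Require Import Defs.
From mathcomp Require Import all_boot all_algebra.
From mathcomp Require Import boolp classical_sets functions.

Set Implicit Arguments.
Unset Strict Implicit.
Unset Printing Implicit Defensive.

Import GRing.Theory.
Local Open Scope ring_scope.

Lemma linear_comp (K : fieldType) (U V W : lmodType K) (g : V -> W) (f : U -> V) :
  linear g -> linear f -> linear (g \o f).
Proof. by move=> ling linf c x y /=; rewrite linf ling. Qed.

Section QuotientMorphism.
Variables (K : fieldType) (X Y : dga K) (I : dg_ideal X) (J : dg_ideal Y).
Variables (f : dga_hom X Y).
Hypothesis fIJ : forall n (x : X n), I n x -> J n (f n x).

Definition dq_map n (q : dq_comp I n) : dq_comp J n := qclass (J n) (f n (qrep q)).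

(** The chosen representative of a class differs from [x] by an element of [I], which [f] sends into
    [J]. Every later identity on quotients is thus checked on classes of elements. *)
Lemma dq_mapE n (x : X n) : dq_map (qclass (I n) x) = qclass (J n) (f n x).
Proof.
apply/qclassP; rewrite -(linB (@dgh_linear _ _ _ f n)).
by apply/fIJ/qclassP; exact: qrepK.
Qed.

Lemma dq_map_linear n : linear (@dq_map n).
Proof.
move=> c p q; have [[x ->] [y ->]] := (dq_surj p, dq_surj q).
by rewrite -qclass_lin !dq_mapE dgh_linear qclass_lin.
Qed.

Lemma dq_map_mul m n (p : dga_quot I m) (q : dga_quot I n) :
  dq_map (dg_mul (dga_quot I) p q) = dg_mul (dga_quot J) (dq_map p) (dq_map q).
Proof.
have [[x ->] [y ->]] := (dq_surj p, dq_surj q).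
by rewrite /= dq_mulE !dq_mapE dgh_mul dq_mulE.
Qed.

Lemma dq_map_one : dq_map (dg_one (dga_quot I)) = dg_one (dga_quot J).
Proof. by rewrite /= dq_mapE dgh_one. Qed.

Lemma dq_map_diff n (q : dga_quot I n) :
  dq_map (dg_diff (dga_quot I) q) = dg_diff (dga_quot J) (dq_map q).
Proof. by have [x ->] := dq_surj q; rewrite /= dq_diffE !dq_mapE dgh_diff dq_diffE. Qed.

Definition dga_quot_hom : dga_hom (dga_quot I) (dga_quot J) :=
  @DgaHom K (dga_quot I) (dga_quot J) dq_map dq_map_linear dq_map_mul dq_map_one dq_map_diff.
End QuotientMorphism.

Section FormMap.
Variables (K : fieldType) (A B : algebra K) (phi : A -> B).
Hypotheses (phi_lin : linear phi)
  (phi_mul : forall a b, phi (alg_mul a b) = alg_mul (phi a) (phi b))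
  (phi_one : phi alg_one = alg_one).

(** This extends [phi] by w da |-> [form_map] w d(phi a). The lifts are total functions; that they
    compute as intended is established in [form_map_step]. *)
Fixpoint form_map (n : nat) : forms A n -> forms B n :=
  match n with
  | 0 => phi
  | m.+1 => tlift (fun w => qlift (fun a => wedge_d (form_map w) (phi a)))
  end.

Lemma form_map_cast m n (e : m = n) (x : forms A m) :
  form_map (degcast e x) = degcast e (form_map x).
Proof. by case: n / e. Qed.

(** Linearity in degree n makes the lifted map bilinear, and only then do the lifts yield linearity
    and the formula in degree n+1; hence the induction carries linearity. *)
Lemma form_map_step n : linear (@form_map n) ->
  linear (@form_map n.+1) /\
  (forall (w : forms A n) a, form_map (wedge_d w a) = wedge_d (form_map w) (phi a)).
Proof.
move=> lin_n; pose f w a := wedge_d (@form_map n w) (phi a).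
have bilf : bilinear_for *:%R *:%R f.
  split=> [a c w w' | w c a a']; rewrite /f /=.
    by rewrite lin_n (wedge_d_bilinear _ _).1.
  by rewrite phi_lin (wedge_d_bilinear _ _).2.
(* Since phi(1) = 1 and d1 = 0, the map factors through A/K in its last argument. *)
have f1 w : f w alg_one = 0 by rewrite /f phi_one wedge_d1.
split; first exact: (form_lift_lin bilf f1).
exact: (form_liftE bilf f1).
Qed.

Lemma form_map_linear n : linear (@form_map n).
Proof. by elim: n => [|n IHn]; [exact: phi_lin | have [] := form_map_step IHn]. Qed.

Lemma form_mapE n (w : forms A n) a :
  form_map (wedge_d w a) = wedge_d (form_map w) (phi a).
Proof. by have [_] := form_map_step (@form_map_linear n); apply. Qed.

Lemma form_map_monom n a : form_map (monom n a) = monom n (phi \o a).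
Proof. by elim: n => [|n IHn] //; rewrite form_mapE IHn. Qed.

Lemma form_map_d n (w : forms A n) : form_map (form_d w) = form_d (form_map w).
Proof.
elim: n w => [|n IHn] w.
  (* In degree 0, da is 1 da, so compatibility with d amounts to phi(1) = 1. *)
  by rewrite [form_d w]/= form_mapE; congr wedge_d; exact: phi_one.
move: w; apply: form_ext => [||w a].
- exact: linear_comp (@form_map_linear _) (@form_d_lin _ _ _).
- exact: linear_comp (@form_d_lin _ _ _) (@form_map_linear _).
by rewrite form_dE !form_mapE form_dE IHn.
Qed.

(** The rule (w da) b = w d(ab) - (w a) db involves only the product of A, which [phi] preserves,
    and the action in lower degree. *)
Lemma form_map_mulr n (w : forms A n) b :
  form_map (form_mulr w b) = form_mulr (form_map w) (phi b).
Proof.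
elim: n w b => [|n IHn] w b; first exact: phi_mul.
move: w; apply: form_ext => [c x y | c x y | w a].
- by rewrite (form_mulr_bilinear _ _).1 form_map_linear.
- by rewrite form_map_linear (form_mulr_bilinear _ _).1.
by rewrite form_mulrE (linB (@form_map_linear _)) !form_mapE form_mulrE IHn phi_mul.
Qed.

Lemma form_map_mul_rev m n (x : forms A m) (y : forms A n) :
  form_map (form_mul_rev x y) = form_mul_rev (form_map x) (form_map y).
Proof.
elim: n y => [|n IHn] y; first exact: form_map_mulr.
move: y; apply: form_ext => [c y y' | c y y' | y b].
- by rewrite (form_mul_rev_bilinear _ _ _).2 form_map_linear.
- by rewrite form_map_linear (form_mul_rev_bilinear _ _ _).2.
by rewrite form_mul_revE !form_mapE form_mul_revE IHn.
Qed.

Lemma form_map_mul m n (x : forms A m) (y : forms A n) :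
  form_map (form_mul x y) = form_mul (form_map x) (form_map y).
Proof. by rewrite /form_mul form_map_cast form_map_mul_rev. Qed.

Definition universal_dga_hom : dga_hom (universal_dga A) (universal_dga B) :=
  @DgaHom K (universal_dga A) (universal_dga B)
    form_map form_map_linear form_map_mul phi_one form_map_d.
End FormMap.

Lemma form_map_id (K : fieldType) (A : algebra K) n :
  @form_map K A A id n =1 id.
Proof.
elim: n => [|n IHn] //; apply: form_ext => [||w a].
- exact: form_map_linear.
- by [].
by rewrite form_mapE // IHn.
Qed.

Lemma form_map_comp (K : fieldType) (A B C : algebra K) (psi : B -> C) (phi : A -> B) n :
    linear psi -> psi alg_one = alg_one -> linear phi -> phi alg_one = alg_one ->
  @form_map K A C (psi \o phi) n =1 @form_map K B C psi n \o @form_map K A B phi n.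
Proof.
move=> lpsi psi1 lphi phi1.
have lc : linear (psi \o phi) by exact: linear_comp.
have c1 : (psi \o phi) alg_one = alg_one by rewrite /= phi1.
elim: n => [|n IHn] //; apply: form_ext => [||w a].
- exact: form_map_linear.
- by apply: linear_comp; exact: form_map_linear.
by rewrite /comp !form_mapE // IHn.
Qed.

Section ConnesFunctor.
Variable K : fieldType.
Implicit Types X Y Z : spectral_triple K.

Section OnMorphisms.
Variables (X Y : spectral_triple K) (f : spectral_hom X Y).
Local Notation phi := (sh_alg f).
Local Notation Phi := (sh_space f).

Definition spectral_form_map : dga_hom (universal_dga (st_alg X)) (universal_dga (st_alg Y)) :=
  universal_dga_hom (sh_alg_linear f) (sh_alg_mul f) (sh_alg_one f).

Lemma sh_commD a v : Phi (commD a v) = commD (phi a) (Phi v).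
Proof. by rewrite /commD (linB (sh_space_linear f)) sh_D !sh_rep sh_D. Qed.

(** Induction peels off the last commutator: pi(w da) = pi(w) [D, a], and [sh_commD] moves [Phi]
    past [D, a]. For fixed [v] both sides are linear in [w], so forms w da suffice. *)
Lemma sh_form_rep n (w : forms (st_alg X) n) v :
  Phi (form_rep w v) = form_rep (form_map phi w) (Phi v).
Proof.
elim: n w v => [|n IHn] w v; first exact: sh_rep.
move: w; apply: form_ext => [c x y | c x y | w a].
- by rewrite form_rep_lin; exact: sh_space_linear.
- rewrite form_map_linear ?form_rep_lin //;
    [exact: sh_alg_linear | exact: sh_alg_one].
rewrite form_mapE; [|exact: sh_alg_linear|exact: sh_alg_one].
by rewrite !form_repE /= IHn sh_commD.
Qed.

Lemma spectral_form_map_J0 n (w : universal_dga (st_alg X) n) :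
  J0 X n w -> J0 Y n (spectral_form_map n w).
Proof.
rewrite /J0 /= /J0_mem => w0; apply/funext => v'.
by have [v <-] := sh_space_surj f v'; rewrite -sh_form_rep w0 (lin0 (sh_space_linear f)).
Qed.

(** The summand in J_0 is handled by the previous lemma; the summand in d J_0 follows because the
    form map commutes with d. *)
Lemma spectral_form_map_J n (w : universal_dga (st_alg X) n) :
  J X n w -> J Y n (spectral_form_map n w).
Proof.
move=> [y [z [Jy dz ->]]]; rewrite (linD (@dgh_linear _ _ _ spectral_form_map n)).
apply: submodD; first by apply: J0_junk; exact: spectral_form_map_J0.
case: n z {w y Jy} dz => [|n] z /=.
  (* In degree 0 the image of d is zero by convention. *)
  by move=> ->; rewrite (lin0 (sh_alg_linear f)); exact: (submod0 (J Y 0)).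
move=> [t Jt ->].
change (J Y n.+1 (spectral_form_map n.+1 (dg_diff (universal_dga _) t))); rewrite dgh_diff.
by apply: dJ0_junk; exact: spectral_form_map_J0.
Qed.

Definition Omega_D_hom : dga_hom (Omega_D X) (Omega_D Y) :=
  dga_quot_hom spectral_form_map_J.

Lemma Omega_D_homE n (w : universal_dga (st_alg X) n) :
  Omega_D_hom n (qclass (J X n) w) = qclass (J Y n) (form_map phi w).
Proof. exact: (dq_mapE spectral_form_map_J). Qed.

(** Each word a_0 [D, a_1] ... [D, a_n] is represented by the monomial a_0 da_1 ... da_n, and
    [opclass] does not depend on the representing form, so the claim reduces to [form_map_monom]. *)
Lemma Omega_D_hom_opclass n r (a : 'I_r -> nat -> st_alg X) :
  Omega_D_hom n (opclass n (\sum_(j < r) opword n (a j))) =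
    opclass n (\sum_(j < r) opword n (fun i => phi (a j i))).
Proof.
rewrite !opclass_opword (lin_sum (@dgh_linear _ _ _ Omega_D_hom n)).
apply: eq_bigr => j _; rewrite -!form_rep_monom !opclassE Omega_D_homE.
congr qclass; apply: form_map_monom; [exact: sh_alg_linear | exact: sh_alg_one].
Qed.
End OnMorphisms.

Lemma Omega_D_hom_id X : Omega_D_hom (spectral_id X) = dga_id (Omega_D X).
Proof.
apply: dga_hom_eq => n q; have [w ->] := dq_surj q.
by rewrite Omega_D_homE /= form_map_id.
Qed.

Lemma Omega_D_hom_comp X Y Z (g : spectral_hom Y Z) (f : spectral_hom X Y) :
  Omega_D_hom (spectral_comp g f) = dga_comp (Omega_D_hom g) (Omega_D_hom f).
Proof.
apply: dga_hom_eq => n q; have [w ->] := dq_surj q.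
(* Writing the composite as two successive applications lets [Omega_D_homE] compute each of them on
   a class. *)
transitivity (Omega_D_hom g n (Omega_D_hom f n (qclass (J X n) w))); last by [].
rewrite !Omega_D_homE; congr qclass.
exact: (form_map_comp (sh_alg_linear g) (sh_alg_one g) (sh_alg_linear f) (sh_alg_one f)).
Qed.
End ConnesFunctor.

(** The second conjunct determines [F] on morphisms: monomials span the forms, with scalars absorbed
    in a_0, so classes of such sums exhaust each degree of [Omega_D]. *)
Theorem lemma2p7 (K : fieldType) :
  exists F : forall X Y : SpecTilde K,
      cat_hom X Y -> @cat_hom (DGA K) (Omega_D X) (Omega_D Y),
    is_functor (C := SpecTilde K) (E := DGA K) (F0 := @Omega_D K) F /\
    forall (X Y : spectral_triple K) (f : spectral_hom X Y) (n r : nat)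
        (a : 'I_r -> nat -> st_alg X),
      dgh_fun (F X Y f) (opclass n (\sum_(j < r) opword n (a j))) =
        opclass n (\sum_(j < r) opword n (fun i => sh_alg f (a j i))).
Proof.
exists (@Omega_D_hom K); split; last exact: Omega_D_hom_opclass.
by split; [exact: Omega_D_hom_id | exact: Omega_D_hom_comp].
Qed.
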